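(* Let $(\mathcal{X},\rho)$ be a Polish space, let $T=\mathbb{R}_+=[0,\infty)$, and let $\{P_t\}_{t\in T}$ be a Markov semigroup of regular Markov operators on $\mathcal{X}$ that is strongly continuous on $C_b(\mathcal{X})$. Then $\{P_t\}_{t\in T}$ satisfies the e-property (at every point of $\mathcal{X}$) if and only if it is Feller (i.e. it is a Markov-Feller semigroup) and satisfies the eventual e-property (at every point of $\mathcal{X}$).
   Context: Notation: $\mathcal{M}(\mathcal{X})$ is the family of finite Borel measures on $\mathcal{X}$; $B_b(\mathcal{X})$, $C_b(\mathcal{X})$, $L_b(\mathcal{X})$ are the spaces of bounded Borel, bounded continuous, and bounded Lipschitz real-valued functions on $\mathcal{X}$, respectively; $\|f\|_\infty=\sup_x|f(x)|$; $\langle f,\mu\rangle=\int_{\mathcal X} f\,d\mu$. A Markov operator is a map $P:\mathcal{M}(\mathcal{X})\to\mathcal{M}(\mathcal{X})$ with $P(\lambda_1\mu_1+\lambda_2\mu_2)=\lambda_1P\mu_1+\lambda_2P\mu_2$ for $\lambda_1,\lambda_2\ge0$, $\mu_1,\mu_2\in\mathcal M(\mathcal X)$, and $P\mu(\mathcal{X})=\mu(\mathcal{X})$. It is regular if there is a linear operator on $B_b(\mathcal{X})$, also denoted $P$, with $\langle f,P\mu\rangle=\langle Pf,\mu\rangle$ for all $f\in B_b(\mathcal{X})$, $\mu\in\mathcal{M}(\mathcal{X})$. It is Markov-Feller if it is regular and $P(C_b(\mathcal{X}))\subset C_b(\mathcal{X})$. A Markov semigroup is a semigroup $\{P_t\}_{t\in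 T}$ ($P_{s+t}=P_sP_t$, $P_0=\mathrm{Id}$) of Markov operators; it is a Markov-Feller semigroup if every $P_t$, $t\in T$, is Markov-Feller. Strong continuity on $C_b(\mathcal{X})$: $\lim_{t\searrow0}\|P_tf-f\|_\infty=0$ for every $f\in C_b(\mathcal{X})$. E-property at $z$: for every $f\in L_b(\mathcal{X})$, $\limsup_{x\to z}\sup_{t\in T}|P_tf(x)-P_tf(z)|=0$. Eventual e-property at $z$: for every $f\in L_b(\mathcal{X})$, $\limsup_{(x,t)\to(z,\infty)}|P_tf(x)-P_tf(z)|=0$; that is, for every $\epsilon>0$ there exist $\delta>0$ and $t_0\in T$ such that $|P_tf(x)-P_tf(z)|<\epsilon$ for all $x$ with $\rho(x,z)<\delta$ and all $t\ge t_0$. *)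

(* Defs.v *)
From HB Require Import structures.
From mathcomp Require Import all_boot all_order all_algebra.
From mathcomp Require Import all_classical all_reals all_analysis.
From mathcomp Require Import giry.

Set Implicit Arguments.
Unset Strict Implicit.
Unset Printing Implicit Defensive.

Import Order.TTheory GRing.Theory Num.Theory.
Import numFieldNormedType.Exports.

Local Open Scope classical_set_scope.
Local Open Scope ring_scope.

HB.mixin Record isSeparable T & Topological T := {
  separable : exists2 A : set T, countable A & dense A
}.

(* The library's completeType is pointed, as are its measurable types: a
   polishType is nonempty. *)
#[short(type="polishType")]
HB.structure Definition Polish (R : realType) :=
  {T of Complete T & Metric R T & isSeparable T}.

Notation borel X := (g_sigma_algebraType (@open X)).

Section function_spaces.
Context {R : realType} {X : polishType R}.
Implicit Type f : X -> R.

Definition Bb f := measurable_fun setT (f : borel X -> R) /\ bounded_fun f.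

Definition Cb f := continuous f /\ bounded_fun f.

(* The library's k.-lipschitz is restricted to normed modules. *)
Definition Lb f :=
  (exists k : R, forall x y, `|f x - f y| <= k * mdist x y) /\ bounded_fun f.

Definition sup_norm f : \bar R := ereal_sup [set `|f x|%:E | x in setT].

End function_spaces.

Section markov_operators.
Context {R : realType} {X : polishType R}.

Local Notation M := {finite_measure set (borel X) -> \bar R}.

(* A library measure carries values on nonmeasurable sets too; measures are
   therefore identified by measure_eq, i.e. when they agree on Borel sets.
   The case a = 1, b = 0 of the first clause says that P respects measure_eq. *)
Definition markov_operator (P : M -> M) :=
  (forall (a b : {nonneg R}) (mu1 mu2 mu : M),
    measure_eq mu (measure_add (mscale a mu1) (mscale b mu2)) ->
    measure_eq (P mu) (measure_add (mscale a (P mu1)) (mscale b (P mu2)))) /\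
  (forall mu : M, P mu setT = mu setT).

(* P is regular when regular_with P U holds for some U, the linear operator on
   Bb that is also denoted P. The values of U outside Bb are unconstrained; on
   Bb, U is determined by P, as the duality at Dirac measures shows. *)
Definition regular_with (P : M -> M) (U : (X -> R) -> (X -> R)) :=
  [/\ forall f, Bb f -> Bb (U f),
      forall (a b : R) f g, Bb f -> Bb g ->
        U (fun x => a * f x + b * g x) = (fun x => a * U f x + b * U g x) &
      forall f (mu : M), Bb f -> \int[P mu]_x f x = \int[mu]_x U f x].

Definition markov_feller (P : M -> M) :=
  markov_operator P /\
  exists2 U, regular_with P U & forall f, Cb f -> Cb (U f).

(* Semigroups are families over R of which only the times t >= 0 matter. *)
Definition markov_semigroup (P : R -> M -> M) :=
  [/\ forall t, 0 <= t -> markov_operator (P t),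
      forall s t, 0 <= s -> 0 <= t ->
        forall mu, measure_eq (P (s + t) mu) (P s (P t mu)) &
      forall mu, measure_eq (P 0 mu) mu].

Definition markov_feller_semigroup (P : R -> M -> M) :=
  markov_semigroup P /\ forall t, 0 <= t -> markov_feller (P t).

End markov_operators.

Section regularity_properties.
Context {R : realType} {X : polishType R}.
Implicit Type U : R -> (X -> R) -> (X -> R).

Definition strongly_continuous U :=
  forall f, Cb f -> sup_norm (U t f \- f) @[t --> 0^'+] --> 0%E.

Definition e_property U (z : X) :=
  forall f, Lb f ->
    limf_esup (fun x => ereal_sup
      [set `|U t f x - U t f z|%:E | t in [set t | 0 <= t]]) (nbhs z) = 0%E.

Definition eventual_e_property U (z : X) :=
  forall f, Lb f ->
    limf_esup (fun xt : X * R => `|U xt.2 f xt.1 - U xt.2 f z|%:E)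
      (filter_prod (nbhs z) +oo) = 0%E.

End regularity_properties.

(* Main.v *)
Require Import Defs.
From HB Require Import structures.
From mathcomp Require Import all_boot all_order all_algebra.
From mathcomp Require Import all_classical all_reals all_analysis.
From mathcomp Require Import measurable_realfun lra.

Set Implicit Arguments.
Unset Strict Implicit.
Unset Printing Implicit Defensive.

Import Order.TTheory GRing.Theory Num.Theory.
Import numFieldNormedType.Exports.

Local Open Scope classical_set_scope.
Local Open Scope ring_scope.

(** The e-property bounds the oscillation |P_t f(x) - P_t f(z)| uniformly over
    all times, the eventual e-property only over late times. What separates the
    two is the behaviour on bounded time intervals, and there the Feller
    property and strong continuity suffice.

    From the e-property to Feller: it makes P_t f continuous for bounded
    Lipschitz f, and this has to be extended to bounded continuous f. Such an f
    is a pointwise limit of uniformly bounded Lipschitz functions g_n <= f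
    (Cb_lipschitz_minorants). By duality at Dirac measures P_t f(x) is an
    integral of f against a finite measure, so P_t g_n(z) -> P_t f(z) by
    dominated convergence, while P_t g_n <= P_t f everywhere. Continuity of
    P_t g_n near z thus bounds P_t f from below near z
    (regular_lower_semicontinuous); the same bound for -f gives continuity
    (feller_of_lipschitz).

    From Feller and the eventual e-property to the e-property: cut a bounded
    time interval into steps of length h so short that P_s f is uniformly close
    to f for 0 < s <= h. Each P_t is a contraction for the supremum norm, so
    P_(kh+s) f = P_kh (P_s f) is uniformly close to P_kh f, and the finitely
    many functions P_kh f are continuous at z. Hence the family P_t f is
    equicontinuous at z over bounded times (equicontinuous_bounded_times), and
    the eventual e-property covers the remaining times. *)

(** * Upper limits of nonnegative functions *)

(** Removes upper limits, and the extended reals with them: both regularity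
    properties become statements about neighbourhoods. *)
Lemma limf_esup_eq0P (T : choiceType) (X : filteredType T) (R : realType)
    (F : set_system X) {PF : ProperFilter F} (f : X -> \bar R) :
  (forall x, 0 <= f x)%E ->
  limf_esup f F = 0%E <->
  forall e : R, 0 < e -> \forall x \near F, (f x <= e%:E)%E.
Proof.
move=> f0; split=> [f_lim e e0|f_small].
  have /ereal_inf_lt[_ [V FV <-] supV] : (limf_esup f F < e%:E)%E.
    by rewrite f_lim lte_fin.
  apply: filterS FV => x Vx.
  by rewrite (le_trans _ (ltW supV))//; apply: ereal_sup_ubound; exists x.
apply/eqP; rewrite eq_le; apply/andP; split; last first.
  by apply: limf_esup_ge0 => //; exact: filter_not_empty.
apply/lee_addgt0Pr => e e0; rewrite add0e.
apply: ereal_inf_le; exists (ereal_sup (f @` [set x | (f x <= e%:E)%E])).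
  by exists [set x | (f x <= e%:E)%E] => //; exact: f_small.
by apply: ge_ereal_sup => _ [x fxe <-].
Qed.

(** * Bounded continuous and bounded Lipschitz functions *)

Section function_spaces_lemmas.
Context {R : realType} {X : polishType R}.
Implicit Types f g : X -> R.

Lemma bounded_funE f : bounded_fun f <-> exists M : R, forall x, `|f x| <= M.
Proof.
split=> [[M [_ fM]]|[M fM]].
  by exists (M + 1) => x; apply: (fM (M + 1)) => //; rewrite ltrDl.
exists M; split; first exact: num_real.
by move=> N MN x _ /=; rewrite (le_trans (fM x))// ltW.
Qed.

Lemma continuousE f :
  continuous f <->
  forall z (e : R), 0 < e -> \forall x \near z, `|f x - f z| <= e.
Proof.
split=> [cf z e e0|cf z].
  have /cvgrPdist_le/(_ e e0) := cf z.
  by apply: filterS => x; rewrite distrC.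
apply/cvgrPdist_le => e e0; apply: filterS (cf z e e0) => x.
by rewrite distrC.
Qed.

Lemma Cb_Bb f : Cb f -> Bb f.
Proof.
move=> [/continuousP cf bf]; split => //.
apply: (measurability _ (RGenOpens.measurableE R)).
move=> _ [_ [a [b ->] <-]]; rewrite setTI.
by apply: sub_sigma_algebra; exact/cf/interval_open.
Qed.

Lemma Lb_Cb f : Lb f -> Cb f.
Proof.
move=> [[k fk] bf]; split=> //; apply/continuousE => z e e0.
have k0 : 0 < `|k| + 1 by rewrite ltr_wpDl.
apply/metricType_numDomainType.nbhs_mdistP.
exists (e / (`|k| + 1)); first exact: divr_gt0.
move=> x /= /ltW zx; rewrite distrC (le_trans (fk z x))//.
rewrite ler_pdivlMr// mulrC in zx; apply: le_trans zx.
rewrite ler_wpM2r ?mdist_ge0//.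
by rewrite (le_trans (ler_norm k))// lerDl.
Qed.

Lemma BbN f : Bb f -> Bb (\- f).
Proof.
move=> [mf /bounded_funE[M fM]]; split; first exact: measurableT_comp mf.
by apply/bounded_funE; exists M => x /=; rewrite normrN.
Qed.

Lemma CbN f : Cb f -> Cb (\- f).
Proof.
move=> [cf /bounded_funE[M fM]]; split.
  by move=> x; apply: cvgN; exact: cf.
by apply/bounded_funE; exists M => x /=; rewrite normrN.
Qed.

(** The inf-convolutions g_n(x) = inf_y (f(y) + n d(x,y)) are n-Lipschitz as
    infima of n-Lipschitz functions of x. They converge to f because for large n
    the penalty n d(x,y) confines the infimum to points y near x, where
    continuity of f applies. *)
Lemma Cb_lipschitz_minorants f (M : R) : Cb f -> (forall x, `|f x| <= M) ->
  exists g : nat -> X -> R,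
    [/\ forall n, Lb (g n), forall n x, g n x <= f x,
        forall n x, `|g n x| <= M &
        forall x, g n x @[n --> \oo] --> f x].
Proof.
move=> [/continuousE cf _] fM.
pose S n x := [set f y + n%:R * mdist x y | y in [set: X]].
pose g n x := inf (S n x).
have nd0 n (x y : X) : 0 <= n%:R * mdist x y :> R.
  by rewrite mulr_ge0// mdist_ge0.
have lbS n x : lbound (S n x) (- M).
  move=> _ [y _ <-]; rewrite -[leLHS]addr0 lerD//.
  by have := fM y; rewrite ler_norml => /andP[].
have S0 n x : S n x !=set0 by exists (f x + n%:R * mdist x x); exists x.
have gf n x : g n x <= f x.
  by apply: ge_inf; [exists (- M)|exists x => //; rewrite mdistxx mulr0 addr0].
have gM n x : `|g n x| <= M.
  rewrite ler_norml lb_le_inf//= (le_trans (gf n x))//.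
  by rewrite (le_trans (ler_norm _)).
have g_le n x y : g n x - g n y <= n%:R * mdist x y.
  rewrite lerBlDr -lerBlDl; apply: lb_le_inf => // _ [w _ <-].
  rewrite lerBlDl; apply: (@le_trans _ _ (f w + n%:R * mdist x w)).
    by apply: ge_inf; [exists (- M)|exists w].
  rewrite addrCA lerD2l -mulrDr ler_wpM2l//; exact: metric_triangle.
exists g; split=> // [n|x].
  split; last by apply/bounded_funE; exists M.
  exists n%:R => x y; rewrite ler_norml g_le andbT.
  by rewrite lerNl opprB metric_sym g_le.
apply/cvgrPdist_le => e e0.
have /metricType_numDomainType.nbhs_mdistP[d /= d0 fd] := cf x e e0.
near=> n.
rewrite ger0_norm ?subr_ge0// lerBlDl -lerBlDr.
apply: lb_le_inf => // _ [y _ <-].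
have [xy|xy] := ltP (mdist x y) d.
  have := fd y xy; rewrite ler_norml => /andP[fxy _].
  by have := nd0 n x y; lra.
(* Outside the d-ball around x the penalty exceeds the oscillation 2M of f. *)
have : 2 * M <= n%:R * mdist x y.
  apply: (@le_trans _ _ (n%:R * d)); last by rewrite ler_wpM2l.
  rewrite -ler_pdivrMr//; near: n; exact: nbhs_infty_ger.
have := fM x; have := fM y; rewrite !ler_norml => /andP[? ?] /andP[? ?] ?.
lra.
Unshelve. all: by end_near. Qed.

End function_spaces_lemmas.

(** * Regular operators as integral operators *)

Section regular_operators.
Context {R : realType} {X : polishType R}.
Local Notation M := {finite_measure set (borel X) -> \bar R}.
Context (P : M -> M) (U : (X -> R) -> (X -> R)).
Context (P_markov : markov_operator P) (PU : regular_with P U).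
Implicit Types f g : X -> R.

Local Notation kernel x := (P (\d_(x : borel X))).

Lemma Bb_integrable (mu : M) f : Bb f -> mu.-integrable setT (EFin \o f).
Proof.
move=> [mf bf]; apply: measurable_bounded_integrable => //.
exact: fin_num_fun_lty.
Qed.

Lemma Rintegral_diracE f (x : X) : Bb f ->
  \int[\d_(x : borel X)]_y f y = f x.
Proof.
move=> [mf _]; rewrite /Rintegral integral_dirac//; last exact/measurable_EFinP.
by rewrite diracT mul1e.
Qed.

(** Duality at a Dirac measure turns U into integration against the measures
    P delta_x. In particular P determines U on bounded Borel functions, and
    order, norm and limit properties of U are those of the integral. *)
Lemma regular_kernelE f x : Bb f -> U f x = \int[kernel x]_y f y.
Proof.
by case: PU => UBb _ dual Bf; rewrite dual// Rintegral_diracE//; exact: UBb.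
Qed.

Lemma kernel_setT x : kernel x setT = 1%E.
Proof. by case: P_markov => _ ->; exact: diracT. Qed.

Lemma regular_contraction f g (e : R) x : Bb f -> Bb g ->
  (forall y, `|f y - g y| <= e) -> `|U f x - U g x| <= e.
Proof.
move=> Bf Bg fg; rewrite !regular_kernelE//.
have iB := integrableB measurableT (Bb_integrable (kernel x) Bf)
  (Bb_integrable (kernel x) Bg).
rewrite -RintegralB//; try exact: Bb_integrable.
apply: le_trans (le_normr_Rintegral _ iB) _ => //.
apply: (@le_trans _ _ (\int[kernel x]_(y in setT) e)).
  apply: le_Rintegral => //; first exact: integrable_norm iB.
  exact/finite_measure_integrable_cst.
by rewrite Rintegral_cst// [X in fine X]kernel_setT mulr1.
Qed.

Lemma regular_le f g x : Bb f -> Bb g -> (forall y, f y <= g y) ->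
  U f x <= U g x.
Proof.
move=> Bf Bg fg; rewrite !regular_kernelE//.
by apply: le_Rintegral => //; exact: Bb_integrable.
Qed.

Lemma regular_cvg (f_ : nat -> X -> R) f (B : R) x :
  (forall n, Bb (f_ n)) -> Bb f -> (forall n y, `|f_ n y| <= B) ->
  (forall y, f_ n y @[n --> \oo] --> f y) ->
  U (f_ n) x @[n --> \oo] --> U f x.
Proof.
move=> Bf_ Bf f_B f_f.
under eq_fun do rewrite regular_kernelE//.
rewrite regular_kernelE//.
have [||||| _ _] := @dominated_convergence _ _ _ (kernel x) _ measurableT
  (fun n => EFin \o f_ n) (EFin \o f) (cst B%:E).
- by move=> n; apply/measurable_EFinP; case: (Bf_ n).
- by apply/measurable_EFinP; case: Bf.
- by apply: aeW => y _; apply: cvg_EFin; [exact: nearW|exact: f_f].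
- exact: finite_measure_integrable_cst.
- by apply: aeW => y n _; rewrite /= lee_fin.
rewrite -[X in _ --> X]fineK.
  exact: fine_cvg.
by apply: integrable_fin_num => //; exact: Bb_integrable.
Qed.

Lemma regularN f x : Bb f -> U (\- f) x = - U f x.
Proof.
move=> Bf; rewrite !regular_kernelE//; last exact: BbN.
rewrite -mulN1r -RintegralZl//; last exact: Bb_integrable.
by apply: eq_Rintegral => y _; rewrite mulN1r.
Qed.

(** Minorants suffice: a single g <= f whose image is e/2-close to U f at z
    keeps U f above U f z - e wherever U g is within e/2 of U g z. *)
Lemma regular_lower_semicontinuous f z (e : R) :
  (forall g, Lb g -> continuous (U g)) -> Cb f -> 0 < e ->
  \forall x \near z, U f z - e <= U f x.
Proof.
move=> UL Cf e0; have Bf := Cb_Bb Cf.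
have [B fB] := (bounded_funE _).1 Cf.2.
have [g [Lg gf gB g_f]] := Cb_lipschitz_minorants Cf fB.
have Bg n : Bb (g n) by exact/Cb_Bb/Lb_Cb.
have e20 : 0 < e / 2 by rewrite divr_gt0.
have /cvgrPdist_le/(_ _ e20)[n _ /(_ n (leqnn n)) gn] :=
  regular_cvg (x := z) Bg Bf gB g_f.
have := (continuousE _).1 (UL _ (Lg n)) z _ e20.
apply: filterS => x; have := regular_le x (Bg n) Bf (gf n).
move: gn; rewrite /= !ler_norml; lra.
Qed.

(** Continuity of images need only be tested on Lipschitz functions: lower
    semicontinuity of U f and of U (- f) = - U f is continuity of U f. *)
Lemma feller_of_lipschitz :
  (forall g, Lb g -> continuous (U g)) -> forall f, Cb f -> Cb (U f).
Proof.
move=> UL f Cf; have Bf := Cb_Bb Cf; split; last first.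
  by case: PU => UBb _ _; case: (UBb f Bf).
apply/continuousE => z e e0.
have := regular_lower_semicontinuous z UL (CbN Cf) e0.
have := regular_lower_semicontinuous z UL Cf e0.
apply: filterS2 => x; rewrite !regularN// ler_norml; lra.
Qed.

End regular_operators.

(** * Equicontinuity over bounded times *)

Section semigroups.
Context {R : realType} {X : polishType R}.
Context (P : R -> {finite_measure set (borel X) -> \bar R} ->
          {finite_measure set (borel X) -> \bar R})
  (U : R -> (X -> R) -> (X -> R)).
Context (P_semigroup : markov_semigroup P)
  (P_regular : forall t, 0 <= t -> regular_with (P t) (U t))
  (U_strongly_continuous : strongly_continuous U).
Implicit Types f : X -> R.

Lemma semigroup0 f : Bb f -> U 0 f = f.
Proof.
move=> Bf; apply/funext => x; case: P_semigroup => _ _ P0.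
rewrite (regular_kernelE (P_regular (lexx 0)))//.
rewrite -[RHS](Rintegral_diracE x Bf) /Rintegral.
by congr fine; apply: eq_measure_integral => A mA _; exact: P0.
Qed.

Lemma semigroupD s t f : 0 <= s -> 0 <= t -> Bb f ->
  U (s + t) f = U t (U s f).
Proof.
move=> s0 t0 Bf; apply/funext => x; case: P_semigroup => _ PD _.
have [UsBb _ dual] := P_regular s0.
rewrite (regular_kernelE (P_regular (addr_ge0 s0 t0)))//.
rewrite (regular_kernelE (P_regular t0)) -?dual; [|by []|exact: UsBb].
rewrite /Rintegral; congr fine.
by apply: eq_measure_integral => A mA _; exact: PD.
Qed.

Lemma strongly_continuous_near f (e : R) : Cb f -> 0 < e ->
  \forall t \near 0^'+, forall x, `|U t f x - f x| <= e.
Proof.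
move=> Cf e0.
have near0 : \forall y \near 0%E, (y < e%:E)%E.
  by apply: open_ereal_lt'; rewrite lte_fin.
have : \forall t \near 0^'+, (sup_norm (U t f \- f)%R < e%:E)%E.
  exact: U_strongly_continuous Cf _ near0.
apply: filterS => t /= /ltW Utf x; rewrite -lee_fin; apply: le_trans Utf.
by apply: ereal_sup_ubound; exists x.
Qed.

(** The time interval is extended by steps of a fixed length h. On the step from
    s = nh to (n+1)h, contractivity of U s transports the estimate
    |U_(t-s) f - f| <= e/3 to |U_t f - U_s f| <= e/3, so there the modulus of
    continuity of the single function U_s f at z serves all times. The bound e
    does not grow along the induction, since each step is compared with its own
    left end only. *)
Lemma equicontinuous_bounded_times f (T e : R) z :
  (forall t, 0 <= t -> forall g, Cb g -> Cb (U t g)) -> Cb f -> 0 < e ->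
  \forall x \near z, forall t, 0 <= t <= T -> `|U t f x - U t f z| <= e.
Proof.
move=> UC Cf e0; have Bf := Cb_Bb Cf.
have e30 : 0 < e / 3 by rewrite divr_gt0.
have [d /= d0 Ud] := strongly_continuous_near Cf e30.
(* U_s f is close to f only for s < d, hence the shorter step h = d / 2. *)
have h0 : 0 < d / 2 by rewrite divr_gt0.
have small s : 0 < s <= d / 2 -> forall x, `|U s f x - f x| <= e / 3.
  move=> /andP[s0 sd]; apply: Ud => //=.
  rewrite sub0r normrN gtr0_norm// (le_lt_trans sd)// ltr_pdivrMr//.
  by rewrite ltr_pMr// ltr1n.
have step n : \forall x \near z,
    forall t, 0 <= t <= n%:R * (d / 2) -> `|U t f x - U t f z| <= e.
  elim: n => [|n IH].
    have := (continuousE _).1 Cf.1 z e e0.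
    apply: filterS => x fxz t; rewrite mul0r -eq_le => /eqP <-.
    by rewrite semigroup0.
  set s := n%:R * (d / 2) in IH *.
  have s0 : 0 <= s by rewrite mulr_ge0// ltW.
  have := (continuousE _).1 (UC s s0 f Cf).1 z _ e30.
  apply: filterS2 IH => x IH Usf t /andP[t0].
  rewrite -natr1 mulrDl mul1r -/s -lerBlDl => ts.
  have [tles|stt] := leP t s; first by apply: IH; rewrite t0.
  have ts0 : 0 < t - s by rewrite subr_gt0.
  have [UBb _ _] := P_regular (ltW ts0).
  have close y : `|U t f y - U s f y| <= e / 3.
    rewrite -{1}(subrK s t) semigroupD//; last exact: ltW.
    apply: (regular_contraction _ (P_regular s0)) => //.
    - by case: P_semigroup => + _ _; apply.
    - exact: UBb.
    - by apply: small; rewrite ts0.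
  by have := close x; have := close z; move: Usf; rewrite !ler_norml; lra.
have [n Tn] : exists n : nat, T / (d / 2) <= n%:R.
  exists (Num.bound `|T / (d / 2)|).
  by rewrite ltW// (le_lt_trans (ler_norm _))// archi_boundP.
rewrite ler_pdivrMr// in Tn.
apply: filterS (step n) => x Ux t /andP[t0 tT].
by apply: Ux; rewrite t0 (le_trans tT).
Qed.

End semigroups.

(** * The e-property and the eventual e-property *)

Section e_properties.
Context {R : realType} {X : polishType R}.
Implicit Type U : R -> (X -> R) -> (X -> R).

Lemma e_propertyP U z : e_property U z <->
  forall f, Lb f -> forall e : R, 0 < e ->
    \forall x \near z, forall t, 0 <= t -> `|U t f x - U t f z| <= e.
Proof.
have pos f (x : X) : (0 <= ereal_sup
    [set `|U t f x - U t f z|%:E | t in [set t : R | (0 <= t)%R]])%E.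
  by apply: le_ereal_sup_tmp; exists `|U 0 f x - U 0 f z|%:E;
    rewrite ?lee_fin//; exists 0 => /=.
split=> E f Lf.
  move=> e e0; have /(limf_esup_eq0P (pos f))/(_ e e0) := E f Lf.
  apply: filterS => x supe t t0; rewrite -lee_fin (le_trans _ supe)//.
  by apply: ereal_sup_ubound; exists t.
apply/(limf_esup_eq0P (pos f)) => e e0.
apply: filterS (E f Lf e e0) => x Ux.
by apply: ge_ereal_sup => _ [t t0 <-]; rewrite lee_fin Ux.
Qed.

Lemma eventual_e_propertyP U z : eventual_e_property U z <->
  forall f, Lb f -> forall e : R, 0 < e ->
    exists T, \forall x \near z, forall t, T <= t ->
      `|U t f x - U t f z| <= e.
Proof.
have pos f (xt : X * R) : (0 <= `|U xt.2 f xt.1 - U xt.2 f z|%:E)%E.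
  by rewrite lee_fin.
split=> E f Lf.
  move=> e e0; have /(limf_esup_eq0P (pos f))/(_ e e0) := E f Lf.
  move=> [[A B] /= [zA [T [_ TB]]] AB].
  (* Neighbourhoods of +oo contain the times t > T; the statement has T <= t. *)
  exists (T + 1).
  apply: filterS zA => x Ax t Tt.
  have := AB (x, t); rewrite /= lee_fin; apply; split=> //=.
  by apply: TB; rewrite (lt_le_trans _ Tt)// ltrDl.
apply/(limf_esup_eq0P (pos f)) => e e0.
have [T UT] := E f Lf e e0.
exists ([set x | forall t, T <= t -> `|U t f x - U t f z| <= e],
  [set t | T <= t]).
  by split => //=; exact: nbhs_pinfty_ge (num_real T).
by move=> [x t] [/= Ux Tt]; rewrite lee_fin Ux.
Qed.

End e_properties.

Theorem proposition3p2 (R : realType) (X : polishType R)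
  (P : R -> {finite_measure set (borel X) -> \bar R} ->
            {finite_measure set (borel X) -> \bar R})
  (U : R -> (X -> R) -> (X -> R))
  (P_semigroup : markov_semigroup P)
  (P_regular : forall t, 0 <= t -> regular_with (P t) (U t))
  (U_strongly_continuous : strongly_continuous U) :
  (forall z, e_property U z) <->
  (markov_feller_semigroup P /\ forall z, eventual_e_property U z).
Proof.
split=> [E|[[_ feller] EE]].
  have UC t : 0 <= t -> forall f, Cb f -> Cb (U t f).
    move=> t0; apply: (feller_of_lipschitz (P_regular t t0)).
    move=> g Lg; apply/continuousE => z e e0.
    have := (e_propertyP _ _).1 (E z) g Lg e e0.
    by apply: filterS => x; apply.
  split.
    split=> // t t0; split; first by case: P_semigroup => + _ _; apply.
    by exists (U t); [exact: P_regular|exact: UC].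
  move=> z; apply/eventual_e_propertyP => f Lf e e0; exists 0.
  exact: (e_propertyP _ _).1 (E z) f Lf e e0.
have UC t : 0 <= t -> forall f, Cb f -> Cb (U t f).
  move=> t0 f Cf; have [_ [V regV VC]] := feller t t0.
  suff -> : U t f = V f by exact: VC.
  apply/funext => x; have Bf := Cb_Bb Cf.
  by rewrite (regular_kernelE (P_regular t t0))// (regular_kernelE regV).
move=> z; apply/e_propertyP => f Lf e e0.
have [T late] := (eventual_e_propertyP _ _).1 (EE z) f Lf e e0.
have early := equicontinuous_bounded_times P_semigroup P_regular
  U_strongly_continuous T z UC (Lb_Cb Lf) e0.
apply: filterS2 late early => x late early t t0.
have [Tt|/ltW tT] := leP T t; first exact: late.
by apply: early; rewrite t0.
Qed.
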